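(* Let $G$ be a bounded degree graph which is quasi-isometric to a tree, and let $\nu$ be a probability measure on $[0,\infty)$ with finite mean. (i) The measure $\nu$ is absolutely continuous with respect to the expected empirical measure of the associated first passage percolation $T$ (it being presupposed that almost surely every two vertices are joined by a $T$-geodesic); that is, for every Borel set $A\subset[0,\infty)$ with $\nu(A)>0$, $$\liminf_{d(x,y)\to\infty}\frac{\mathbb{E}\big[\sum_{e\in\pi}\mathbf{1}_{w(e)\in A}\big]}{d(x,y)}>0,$$ where $\pi$ denotes the $T$-geodesic from $x$ to $y$. (ii) Moreover, if $\nu$ strictly stochastically dominates a probability measure $\tilde\nu$ on $[0,\infty)$ with finite mean, then $$\liminf_{d(x,y)\to\infty}\frac{\mathbb{E}T(x,y)-\mathbb{E}\tilde T(x,y)}{d(x,y)}>0 .$$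
   Context: **Graphs.** A graph $G=(V,E)$ is a pair of sets with a boundary map from $E$ to the two-element subsets of $V$ (parallel edges allowed, no self-loops). The ambient graph is always assumed connected, locally finite, and with $V$ countably infinite. A path is an alternating sequence of vertices and edges, starting and ending with a vertex, in which the two vertices next to an edge form its boundary; we identify a path with its set of edges. A path is self-avoiding if it has no repeated vertices. $d$ is the graph distance. Trees carry their graph metric. **First passage percolation.** Given a probability measure $\nu$ on $[0,\infty)$, let $(w(e))_{e\in E}$ be i.i.d. with law $\nu$, $T(\pi)=\sum_{e\in\pi}w(e)$ for a path $\pi$ without repeated edges, and $T(x,y)=\inf\{T(\gamma):\gamma \text{ a self-avoiding path from } x \text{ to } y\}$. $\tilde T$ is defined in the same way from $\tilde\nu$. A $T$-geodesic from $x$ to $y$ is a self-avoiding path $\pi$ from $x$ to $y$ with $T(\pi)=T(x,y)$; an arbitrary well-ordering of the self-avoiding paths of $G$ is fixed, and ''the'' $T$-geodesic from $x$ to $y$ is the least $T$-geodesic in this ordering. **Strict stochastic domination.** $\nu$ strictly stochastically dominates $\tilde\nu$ if $\tilde\nu\neq\nu$ and there is a coupling $(\tilde w,w)$ of $\tilde\nu$ and $\nu$ with $\tilde w\le w$ almost surely. *)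

(* Defs.v *)
From HB Require Import structures.
From mathcomp Require Import all_boot all_order all_algebra.
From mathcomp Require Import finmap.
From mathcomp Require wochoice.
From mathcomp Require Import all_classical all_reals all_analysis.

Set Implicit Arguments.
Unset Strict Implicit.
Unset Printing Implicit Defensive.
Import Order.TTheory GRing.Theory Num.Theory.

Local Open Scope classical_set_scope.
Local Open Scope ring_scope.

(* Parallel edges are allowed: [ends] need not be injective. *)
Record multigraph := Multigraph {
  vertex : choiceType;
  edge : choiceType;
  ends : edge -> {fset vertex};
  card_ends : forall e, #|` ends e| = 2%N
}.

Section Graphs.
Variable G : multigraph.
Local Notation V := (vertex G).
Local Notation E := (edge G).

(* The alternating sequence x, e1, z1, ..., ek, zk is represented by its first
   vertex x and the list of pairs [:: (e1, z1); ...; (ek, zk)]. *)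
Fixpoint is_path (x : V) (p : seq (E * V)) (y : V) : bool :=
  if p is (e, z) :: p' then (ends e == [fset x; z]%fset) && is_path z p' y
  else x == y.

Definition self_avoiding (x : V) (p : seq (E * V)) : bool :=
  uniq (x :: unzip2 p).

(* Self-avoiding paths from x to y, identified with their sets of edges. *)
Definition sa_paths (x y : V) : set {fset E} :=
  [set [fset e in unzip1 p]%fset | p in
     [set p | is_path x p y && self_avoiding x p]].

Definition all_sa_paths : set {fset E} :=
  [set s | exists x y, sa_paths x y s].

Definition sa_well_ordering (le : rel {fset E}) : Prop :=
  wochoice.wo_chain le [pred s | `[< all_sa_paths s >]].

Definition connected_graph : Prop := forall x y, exists p, is_path x p y.

Definition incident (x : V) : set E := [set e | x \in ends e].

Definition locally_finite : Prop := forall x, finite_set (incident x).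

Definition bounded_degree : Prop :=
  exists D : nat, forall x, (incident x #<= `I_D)%card.

Definition ambient_graph : Prop :=
  [/\ connected_graph, locally_finite & ([set: V] #= [set: nat])%card].

(* The default value 0 is only used when x and y are not connected. *)
Definition gdist (x y : V) : nat :=
  xget 0%N [set n | (exists2 p, is_path x p y & size p = n) /\
                    (forall p, is_path x p y -> (n <= size p)%N)].

(* A cycle is a closed path without repeated edges and without repeated
   vertices other than its starting point; two parallel edges form a cycle. *)
Definition acyclic : Prop :=
  forall x p, is_path x p x -> uniq (unzip1 p) -> uniq (unzip2 p) -> p = [::].

Definition is_tree : Prop := connected_graph /\ acyclic.

(* liminf of f x y as d(x,y) tends to infinity:
   sup over n of the infimum of f over the pairs at distance at least n. *)
Definition liminf_dist (R : realType) (f : V -> V -> \bar R) : \bar R :=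
  ereal_sup [set ereal_inf [set f xy.1 xy.2 | xy in
                [set xy : V * V | (n <= gdist xy.1 xy.2)%N]] | n in [set: nat]].

End Graphs.

Definition quasi_isometry (R : realType) (G H : multigraph)
    (f : vertex G -> vertex H) (K C : R) : Prop :=
  [/\ 1 <= K, 0 <= C,
      forall x y,
        K^-1 * (gdist x y)%:R - C <= (gdist (f x) (f y))%:R
          <= K * (gdist x y)%:R + C
    & forall z, exists x, (gdist (f x) z)%:R <= C].

Definition quasi_isometric_to_tree (R : realType) (G : multigraph) : Prop :=
  exists (H : multigraph) (f : vertex G -> vertex H) (K C : R),
    is_tree H /\ quasi_isometry f K C.

Section FirstPassage.
Variables (R : realType) (G : multigraph).
Implicit Types (w : edge G -> R) (x y : vertex G).

Definition path_time w (s : {fset edge G}) : R := \sum_(e <- s) w e.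

Definition passage_time w x y : R :=
  inf [set path_time w s | s in sa_paths x y].

Definition geodesics w x y : set {fset edge G} :=
  [set s | sa_paths x y s /\ path_time w s = passage_time w x y].

(* The least geodesic for the ordering [le]; the default value [fset0] is only
   used when there is no geodesic. *)
Definition the_geodesic (le : rel {fset edge G}) w x y : {fset edge G} :=
  xget fset0 [set s | geodesics w x y s /\
                      forall s', geodesics w x y s' -> le s s'].

Definition edge_count (s : {fset edge G}) w (A : set R) : R :=
  \sum_(e <- s) \1_A (w e).

End FirstPassage.

Section Weights.
Variable R : realType.

Definition prob_nonneg (nu : probability (measurableTypeR R) R) : Prop :=
  nu `[0, +oo[%classic = 1%E.

Definition finite_mean (nu : probability (measurableTypeR R) R) : Prop :=
  nu.-integrable setT (fun r : R => r%:E).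

Definition has_law d (Omega : measurableType d) (P : probability Omega R)
    (X : {RV P >-> R}) (nu : probability (measurableTypeR R) R) : Prop :=
  forall A : set R, measurable A -> distribution P X A = nu A.

Definition mutually_independent (I : choiceType) d (Omega : measurableType d)
    (P : probability Omega R) (X : I -> {RV P >-> R}) : Prop :=
  forall (J : {fset I}) (A : I -> set R), (forall i, measurable (A i)) ->
    P (\bigcap_(i in [set` J]) X i @^-1` A i) =
    (\prod_(i <- J) P (X i @^-1` A i))%E.

(* The weights take their values in [0, +oo) everywhere, not just almost
   surely, so that the infima defining passage times are always genuine. *)
Definition iid_weights (G : multigraph) d (Omega : measurableType d)
    (P : probability Omega R) (nu : probability (measurableTypeR R) R)
    (w : edge G -> {RV P >-> R}) : Prop :=
  [/\ forall e t, 0 <= w e t,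
      forall e, has_law (w e) nu
    & mutually_independent w].

(* Measures are compared on Borel sets only: [probability] objects are
   functions on all sets, unconstrained on the nonmeasurable ones. *)
Definition strictly_dominates (nu nu' : probability (measurableTypeR R) R) :
    Prop :=
  (exists A : set R, measurable A /\ nu' A <> nu A) /\
  (exists (d : measure_display) (Omega : measurableType d)
          (P : probability Omega R) (X' X : {RV P >-> R}),
     [/\ has_law X' nu', has_law X nu & {ae P, forall t, X' t <= X t}]).

End Weights.

(* Main.v *)
Require Import Defs.
From HB Require Import structures.
From mathcomp Require Import all_boot all_order all_algebra.
From mathcomp Require Import finmap zify.
From mathcomp Require Import all_classical all_reals all_analysis.
From mathcomp Require Import measurable_realfun.

Set Implicit Arguments.
Unset Strict Implicit.
Unset Printing Implicit Defensive.
Import Order.TTheory GRing.Theory Num.Theory.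
Import numFieldNormedType.Exports.

Local Open Scope classical_set_scope.
Local Open Scope ring_scope.

(** A graph quasi-isometric to a tree has bottlenecks at a positive rate along
    every geodesic.  Let [f] be a quasi-isometry into a tree and [u] a vertex on
    the tree path from [f x] to [f y].  A path of the graph from [x] to [y] is
    mapped to a sequence of points at bounded distance from each other, and by
    uniqueness of paths in a tree ([tree_walk_covers]) joining these points by
    tree paths gives a walk through [u].  So the path meets the set of vertices
    whose image is close to [u], a set of bounded diameter, hence of bounded
    cardinality since degrees are bounded.  Taking the edges incident to such
    sets for vertices [u] spaced far enough apart yields [quasi_tree_cutsets]:
    a number of pairwise disjoint edge sets proportional to [gdist x y], each of
    bounded size, each met by every path from [x] to [y].

    Fix an event of positive probability [p] for one edge.  It holds
    simultaneously on all of a cutset [F i] with probability at least [p ^+ N],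
    [N] being the size bound, and then every path from [x] to [y], whatever it
    is, contains an edge of [F i] where the event holds.  Summing over the
    disjoint cutsets ([disjoint_family_sum_le]) gives a linear lower bound.

    For (i) the event is that the weight lies in [A]: every path, in particular
    the geodesic, contains on average linearly many edges with weight in [A]
    ([path_edge_count_ge]).

    For (ii) take a coupling [X' <= X] of the two laws and [delta > 0] with
    [delta <= X - X'] on an event of positive probability; this is the event
    used.  With independent copies of the coupling on the edges, the time of
    every path drops by at least [delta] per good cutset, so the infimum over
    the paths does too.  Independent copies are needed only for finitely many
    edges: the infimum over finitely many paths is a function of finitely many
    weights, its expectation depends only on their joint law
    ([product_law_integral]), and this gives [best_time_gap] between the two
    original probability spaces.  Dominated convergence then passes from
    finitely many paths to all of them ([passage_time_gap]). *)

(** * Paths in multigraphs *)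

Section Paths.
Variable G : multigraph.
Local Notation V := (vertex G).
Local Notation E := (edge G).
Implicit Types (x y z : V) (e : E) (p q : seq (E * V)).

Lemma ends_neq e x y : ends e == [fset x; y]%fset -> x != y.
Proof.
by move=> /eqP exy; have := card_ends e; rewrite exy cardfs2; case: eqP.
Qed.

Lemma self_avoiding_cons x e z p :
  self_avoiding x ((e, z) :: p) = (x \notin z :: unzip2 p) && self_avoiding z p.
Proof. by []. Qed.

Lemma is_path_last x p y : is_path x p y -> last x (unzip2 p) = y.
Proof. by elim: p x => [x /eqP//|[e z] p IH x /= /andP[_ /IH]]. Qed.

Lemma is_path_cat x p q y :
  is_path x (p ++ q) y = is_path x p (last x (unzip2 p)) &&
                         is_path (last x (unzip2 p)) q y.
Proof. by elim: p x => [x|[e z] p IH x] /=; rewrite ?eqxx // IH andbA. Qed.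

Lemma is_path_rev x p y : is_path x p y ->
  exists q, [/\ is_path y q x, size q = size p &
                {subset y :: unzip2 q <= x :: unzip2 p}].
Proof.
elim: p x => [x /eqP <-|[e z] p IH x /= /andP[exz /IH[q [qP sq sub]]]].
  by exists [::]; split => /=.
exists (q ++ [:: (e, x)]); split.
- by rewrite is_path_cat (is_path_last qP) qP /= fsetUC exz eqxx.
- by rewrite size_cat sq addn1.
- move=> v; rewrite /unzip2 map_cat -cat_cons mem_cat => /orP[/sub|].
    by rewrite !inE => ->; rewrite orbT.
  by rewrite !inE => ->.
Qed.

Lemma is_path_ends x p y e v :
  is_path x p y -> e \in unzip1 p -> v \in ends e -> v \in x :: unzip2 p.
Proof.
elim: p x => [//|[e' z] p IH x /= /andP[/eqP exz zp]].
rewrite inE => /orP[/eqP ->|ep ve].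
  by rewrite exz !inE orbA => ->.
by rewrite inE (IH z) ?orbT.
Qed.

Lemma self_avoiding_uniq_edges x p y :
  is_path x p y -> self_avoiding x p -> uniq (unzip1 p).
Proof.
elim: p x => [//|[e z] p IH x /= /andP[exz zp]].
rewrite /self_avoiding -/unzip2 /= => /andP[xp zpu].
rewrite (IH z) // andbT; apply: contra xp => ep.
by apply: (is_path_ends zp ep); rewrite (eqP exz) !inE eqxx.
Qed.

Lemma self_avoiding_suffix x z p y :
  is_path x p y -> self_avoiding x p -> z \in x :: unzip2 p ->
  exists q, [/\ is_path z q y, self_avoiding z q, (size q <= size p)%N &
                {subset z :: unzip2 q <= x :: unzip2 p}].
Proof.
elim: p x => [|[e u] p IH] x.
  move=> /eqP <- _ /[!inE] /eqP ->.
  by exists [::]; split; rewrite /self_avoiding /=.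
rewrite inE => xp sax /orP[/eqP ->|zp]; first by exists ((e, u) :: p); split.
case/andP: (xp) => _ up; move: sax; rewrite self_avoiding_cons => /andP[_ sau].
have [q [qP saq sq sub]] := IH u up sau zp; exists q; split=> //.
  exact: leqW.
by move=> v /sub vp; rewrite inE vp orbT.
Qed.

(** Keeping the length under control makes geodesics self-avoiding for free,
    see [self_avoiding_geodesic]. *)
Lemma loop_erasure x p y : is_path x p y ->
  exists q, [/\ is_path x q y, self_avoiding x q, (size q <= size p)%N &
                {subset x :: unzip2 q <= x :: unzip2 p}].
Proof.
elim: p x => [x xy|[e z] p IH x /= /andP[exz /IH[q [qP saq sq sub]]]].
  by exists [::]; split.
have [xq|xq] := boolP (x \in z :: unzip2 q).
  have [q' [q'P saq' sq' sub']] := self_avoiding_suffix qP saq xq.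
  exists q'; split=> //; first exact/leqW/(leq_trans sq').
  by move=> v /sub' /sub vp; rewrite inE vp orbT.
exists ((e, z) :: q); split; rewrite /= ?exz //.
  by rewrite self_avoiding_cons xq.
by move=> v; rewrite inE => /orP[/eqP ->|/sub vp]; rewrite inE ?eqxx ?vp ?orbT.
Qed.

Lemma edge_at_path_vertex x p y v :
  is_path x p y -> p != [::] -> v \in x :: unzip2 p ->
  exists2 e, e \in unzip1 p & v \in ends e.
Proof.
elim: p x => [//|[e z] p IH x /= /andP[/eqP exz zp] _].
rewrite inE => /predU1P[->|vp].
  by exists e; rewrite ?exz !inE eqxx.
have [p0|p0] := eqVneq p [::].
  move: vp; rewrite p0 inE => /eqP ->.
  by exists e; rewrite ?exz !inE eqxx ?orbT.
by have [e' e'p ve'] := IH z zp p0 vp; exists e'; rewrite // inE e'p orbT.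
Qed.

End Paths.

(** * Uniqueness of paths in trees *)

Section Trees.
Variable H : multigraph.
Hypothesis acyclicH : acyclic H.
Implicit Types (x y : vertex H) (p q : seq (edge H * vertex H)).

(** If two self-avoiding paths from [x] leave it by different edges, then their
    tails, joined at [y], form a walk avoiding [x]; after loop erasure the two
    first edges close it up to a cycle (of length two if these edges are
    parallel). *)
Lemma tree_path_unique x y p q :
  is_path x p y -> self_avoiding x p -> is_path x q y -> self_avoiding x q ->
  p = q.
Proof.
elim: p x q => [|[e z] p IH] x [|[e' z'] q] //.
- move=> /eqP <- _ xq; rewrite /self_avoiding /= -(is_path_last xq) /=.
  by rewrite mem_last.
- move=> xp sap /eqP xy; move: sap; rewrite /self_avoiding /= {1}xy.
  by rewrite -(is_path_last xp) /= mem_last.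
rewrite !self_avoiding_cons /= => /andP[exz zp] /andP[xNp sap].
move=> /andP[exz' z'q] /andP[xNq saq].
have [ee'|ee'] := eqVneq e e'.
  have zz' : z = z'.
    have : z \in [fset x; z']%fset.
      by rewrite -(eqP exz') -ee' (eqP exz) !inE eqxx orbT.
    rewrite !inE eq_sym (negPf (ends_neq exz)) /= => /eqP //.
  by rewrite -ee' -zz'; congr (_ :: _); apply: (IH z) => //; rewrite zz'.
exfalso.
have [q' [q'P _ subq']] := is_path_rev z'q.
have pq' : is_path z (p ++ q') z'.
  by rewrite is_path_cat (is_path_last zp) zp.
have [r [rP sar _ subr]] := loop_erasure pq'.
have xNr : x \notin z :: unzip2 r.
  apply/negP => /subr; rewrite /unzip2 map_cat -cat_cons mem_cat (negPf xNp) /=.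
  move=> xq'; have : x \in y :: unzip2 q' by rewrite inE xq' orbT.
  by move=> /subq'; rewrite (negPf xNq).
have Nr e0 : x \in ends e0 -> e0 \notin unzip1 r.
  by move=> xe0; apply: contra xNr => e0r; exact: (is_path_ends rP e0r xe0).
suff : (e, z) :: (r ++ [:: (e', x)]) = [::] by [].
apply: (acyclicH (x := x)).
- rewrite /= exz is_path_cat (is_path_last rP) rP /= eqxx andbT.
  by rewrite fsetUC.
- rewrite /= /unzip1 map_cat cats1 mem_rcons inE (negPf ee') /=.
  rewrite Nr ?(eqP exz) ?inE ?eqxx //= rcons_uniq Nr ?(eqP exz') ?inE ?eqxx //=.
  exact: self_avoiding_uniq_edges rP sar.
- rewrite /= /unzip2 map_cat cats1 /= mem_rcons inE.
  move: sar xNr; rewrite /self_avoiding /= inE negb_or => /andP[zr ur] /andP[xz xr].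
  by rewrite eq_sym (negPf xz) (negPf zr) rcons_uniq xr ur.
Qed.

(** The loop erasure of the walk is the unique self-avoiding path. *)
Lemma tree_walk_covers x y p q :
  is_path x p y -> self_avoiding x p -> is_path x q y ->
  {subset x :: unzip2 p <= x :: unzip2 q}.
Proof.
move=> xp sap /loop_erasure[q' [q'P saq' _ sub]].
by rewrite (tree_path_unique xp sap q'P saq').
Qed.

End Trees.

(** * Graph distance and geodesics *)

Section Distance.
Variable G : multigraph.
Hypothesis connG : connected_graph G.
Local Notation V := (vertex G).
Implicit Types x y z : V.

Let gdistP x y :
  (exists2 p, is_path x p y & size p = gdist x y) /\
  (forall p, is_path x p y -> (gdist x y <= size p)%N).
Proof.
rewrite /gdist; set D := [set n | _].
suff /(xgetPex 0%N) : exists n, D n by [].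
have ex : exists n, `[< exists2 p, is_path x p y & size p = n >].
  by have [p xp] := connG x y; exists (size p); apply/asboolP; exists p.
exists (ex_minn ex); case: ex_minnP => n /asboolP[p xp <-] mn; split.
  by exists p.
by move=> q xq; apply: mn; apply/asboolP; exists q.
Qed.

Lemma gdist_path x y : exists2 p, is_path x p y & size p = gdist x y.
Proof. by case: (gdistP x y). Qed.

Lemma gdist_le_size x p y : is_path x p y -> (gdist x y <= size p)%N.
Proof. by case: (gdistP x y) => _; exact. Qed.

Lemma gdist_sym x y : gdist x y = gdist y x.
Proof.
wlog suff le : x y / (gdist x y <= gdist y x)%N.
  by apply/eqP; rewrite eqn_leq !le.
have [p yp <-] := gdist_path y x; have [q [xq <- _]] := is_path_rev yp.
exact: gdist_le_size.
Qed.

Lemma gdist_triangle y x z : (gdist x z <= gdist x y + gdist y z)%N.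
Proof.
have [p xp <-] := gdist_path x y; have [q yq <-] := gdist_path y z.
rewrite -size_cat; apply: gdist_le_size.
by rewrite is_path_cat (is_path_last xp) xp.
Qed.

Lemma gdist0 x : gdist x x = 0%N.
Proof. by apply/eqP; rewrite -leqn0 (@gdist_le_size x [::] x) //=. Qed.

Lemma gdist_adjacent e x y : ends e == [fset x; y]%fset -> (gdist x y <= 1)%N.
Proof.
by move=> exy; apply: (@gdist_le_size x [:: (e, y)] y); rewrite /= exy eqxx.
Qed.

Lemma gdist_edge_vertices e x y :
  x \in ends e -> y \in ends e -> (gdist x y <= 1)%N.
Proof.
move=> xe ye; have [->|xy] := eqVneq x y; first by rewrite gdist0.
apply: (@gdist_adjacent e); rewrite eq_sym eqEfcard card_ends cardfs2 xy andbT.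
by apply/fsubsetP => z; rewrite !inE => /orP[] /eqP ->.
Qed.

Lemma gdist_on_path x p y v :
  is_path x p y -> v \in x :: unzip2 p -> (gdist x v <= size p)%N.
Proof.
elim: p x => [x _ /[!inE] /eqP ->|[e z] p IH x /= /andP[exz zp]].
  by rewrite gdist0.
rewrite inE => /predU1P[->|vp]; first by rewrite gdist0.
rewrite (leq_trans (gdist_triangle z x v)) // -add1n.
by rewrite leq_add ?(gdist_adjacent exz) ?IH.
Qed.

Lemma self_avoiding_geodesic x y :
  exists p, [/\ is_path x p y, self_avoiding x p & size p = gdist x y].
Proof.
have [p xp sp] := gdist_path x y; have [q [xq saq sq _]] := loop_erasure xp.
by exists q; split=> //; apply/eqP; rewrite eqn_leq -{1}sp sq gdist_le_size.
Qed.

(** A shortcut between the vertices at positions [i] and [j] would shorten the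
    geodesic. *)
Lemma geodesic_separation x p y (i j : nat) : is_path x p y ->
  size p = gdist x y -> (j <= size p)%N ->
  (j <= i + gdist (last x (unzip2 (take i p))) (last x (unzip2 (take j p))))%N.
Proof.
set u := fun k => last x (unzip2 (take k p)) => xp sp jp; rewrite -/(u i) -/(u j).
have xu k : is_path x (take k p) (u k) && is_path (u k) (drop k p) y.
  by rewrite -is_path_cat cat_take_drop.
have /andP[/gdist_le_size xui _] := xu i; have /andP[_ /gdist_le_size ujy] := xu j.
have := gdist_triangle (u i) x y; have := gdist_triangle (u j) (u i) y.
move: xui ujy; rewrite size_drop -sp.
have := geq_minl i (size p); rewrite -size_take_min.
lia.
Qed.

End Distance.

(** * Bounded degree *)

Section BoundedDegree.
Variable G : multigraph.

Lemma size_flatten_le (T U : Type) (f : T -> seq U) (N : nat) (s : seq T) :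
  (forall x, size (f x) <= N)%N ->
  (size (flatten [seq f x | x <- s]) <= size s * N)%N.
Proof.
by move=> fN; elim: s => //= x s IH; rewrite size_cat mulSn leq_add.
Qed.

Lemma incident_seq : bounded_degree G ->
  exists D : nat, forall x, exists2 s : seq (edge G),
    (size s <= D)%N & forall e, x \in ends e -> e \in s.
Proof.
move=> [D degD]; exists D => x.
have fin : finite_set (incident x) by apply: card_le_finite (degD x) _.
exists (fset_set (incident x)).
  by exact: geq_card_fset_set (degD x).
by move=> e xe; rewrite in_fset_set // inE.
Qed.

(** Bounded degree makes balls finite, with a bound that depends on the radius
    only; what is counted here are the edges incident to the ball. *)
Lemma ball_edges (r : nat) : bounded_degree G ->
  exists N : nat, forall v, exists s : seq (edge G),
    (size s <= N)%N /\ forall p y e,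
      is_path v p y -> (size p <= r)%N -> y \in ends e -> e \in s.
Proof.
move=> /incident_seq[D inc]; elim: r => [|r [N IH]].
  exists D => v; have [s sD sP] := inc v; exists s; split=> // p y e.
  by rewrite leqn0 size_eq0 => + /eqP p0; rewrite p0 => /eqP <- /sP.
have [b bP] := choice IH.
exists (D + D * (2 * N))%N => v; have [s sD sP] := inc v.
exists (s ++ flatten [seq flatten [seq b u | u <- enum_fset (ends e)] | e <- s]); split.
  rewrite size_cat leq_add // (leq_trans _ (leq_mul sD (leqnn _))) //.
  apply: size_flatten_le => e.
  by rewrite -(card_ends e); apply: size_flatten_le => u; case: (bP u).
move=> [|[e z] p] y e0 /=.
  by move=> /eqP <- _ /sP e0s; rewrite mem_cat e0s.
move=> /andP[/eqP evz zp] pr ye0; rewrite mem_cat; apply/orP; right.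
apply/flattenP; exists (flatten [seq b u | u <- enum_fset (ends e)]).
  by apply/mapP; exists e => //; apply: sP; rewrite evz !inE eqxx.
apply/flattenP; exists (b z); last exact: (bP z).2 zp pr ye0.
by apply/mapP; exists z => //; rewrite evz !inE eqxx orbT.
Qed.

End BoundedDegree.

(** * Cutsets in graphs quasi-isometric to trees *)

(** The upper bound is needed between adjacent vertices only, to follow a path;
    the lower bound makes the cutsets small and numerous. *)
Lemma quasi_isometry_nat (R : realType) (G H : multigraph)
    (f : vertex G -> vertex H) (K C : R) : quasi_isometry f K C ->
  exists2 c : nat, (0 < c)%N & forall x y,
    ((gdist x y <= 1)%N -> (gdist (f x) (f y) <= c)%N) /\
    (gdist x y <= c * (gdist (f x) (f y) + c))%N.
Proof.
move=> [K1 C0 qi _]; have KC0 : 0 <= K + C by rewrite addr_ge0 // (le_trans ler01).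
set c := Num.bound (K + C); have cP : K + C < c%:R by exact: archi_boundP.
have K0 : 0 < K by rewrite (lt_le_trans ltr01).
exists c => [|x y]; first by rewrite -(ltr_nat R) (le_lt_trans KC0).
have /andP[lo hi] := qi x y; split.
  move=> d1; rewrite -(ler_nat R) (le_trans hi) // (le_trans _ (ltW cP)) // lerD2r.
  by rewrite ler_piMr ?(ltW K0) // (ler_nat R _ 1).
rewrite -(ler_nat R) natrM natrD.
have : (gdist x y)%:R <= K * ((gdist (f x) (f y))%:R + C).
  by rewrite -ler_pdivrMl // -lerBlDr.
move=> /le_trans; apply; apply: ler_pM => //; first exact: ltW.
- by rewrite addr_ge0.
- by rewrite (le_trans _ (ltW cP)) // lerDl.
- by rewrite lerD2l (le_trans _ (ltW cP)) // lerDr ltW.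
Qed.

Section Cutsets.
Variables (G H : multigraph) (f : vertex G -> vertex H) (c : nat).
Hypotheses (connG : connected_graph G) (connH : connected_graph H).
Hypothesis acyclicH : acyclic H.
Hypothesis fLip : forall x y,
  (gdist x y <= 1)%N -> (gdist (f x) (f y) <= c)%N.

(** The walk follows tree geodesics between the images of successive vertices,
    which have length at most [c]. *)
Lemma image_walk x p y : is_path x p y ->
  exists2 q, is_path (f x) q (f y) & forall u, u \in f x :: unzip2 q ->
    exists2 v, v \in x :: unzip2 p & (gdist (f v) u <= c)%N.
Proof.
elim: p x => [x /eqP <-|[e z] p IH x /= /andP[exz /IH[q zq qP]]].
  exists [::] => [|u]; rewrite /= ?eqxx // inE => /eqP ->.
  by exists x; rewrite ?inE ?eqxx // gdist0.
have [q1 xq1 sq1] := gdist_path connH (f x) (f z).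
exists (q1 ++ q); first by rewrite is_path_cat (is_path_last xq1) xq1.
move=> u; rewrite /unzip2 map_cat -cat_cons mem_cat => /orP[uq1|uq].
  exists x; first by rewrite inE eqxx.
  rewrite (leq_trans (gdist_on_path connH xq1 uq1)) // sq1 fLip //.
  exact: (gdist_adjacent connG exz).
have [|v vp vu] := qP u; first by rewrite inE uq orbT.
by exists v => //; rewrite inE vp orbT.
Qed.

(** The bottleneck property of graphs quasi-isometric to trees. *)
Lemma paths_pass_near_tree_geodesic x y p q u :
  is_path (f x) q (f y) -> self_avoiding (f x) q -> u \in f x :: unzip2 q ->
  is_path x p y ->
  exists2 v, v \in x :: unzip2 p & (gdist (f v) u <= c)%N.
Proof.
move=> fq saq uq /image_walk[q' q'P]; apply.
exact: (tree_walk_covers acyclicH fq saq q'P).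
Qed.

End Cutsets.


(** The cutset [F i] consists of the edges incident to the vertices mapped within
    distance [c] of the vertex at position [l * i] of the tree geodesic.  An edge
    common to two cutsets would bring two such positions within distance
    [3 * c < l].  The bound [n0] makes room for at least one cutset, so that a
    factor [M] can absorb the additive constants. *)
Theorem quasi_tree_cutsets (R : realType) (G : multigraph) :
  connected_graph G -> bounded_degree G -> quasi_isometric_to_tree R G ->
  exists N M n0 : nat, forall x y : vertex G, (n0 <= gdist x y)%N ->
  exists (k : nat) (F : nat -> {fset edge G}),
    [/\ (0 < gdist x y <= M * k)%N,
        forall i, (#|` F i| <= N)%N,
        forall i j e, e \in F i -> e \in F j -> i = j
      & forall s, sa_paths x y s ->
          forall i, (i < k)%N -> exists2 e, e \in F i & e \in s].
Proof.
move=> connG degG [H [f [K [C [[connH acyclicH] qi]]]]].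
have [c c0 fP] := quasi_isometry_nat qi.
have fLip x y := (fP x y).1; have fexp x y := (fP x y).2.
have [N ball] := ball_edges (c * (c + c + c)) degG.
pose l := (3 * c).+1.
exists N, (c * (2 * l + c))%N, (c * (l + c)).+1 => x y xy.
have [q [fq saq sq]] := self_avoiding_geodesic connH (f x) (f y).
set L := size q in sq.
pose u i := last (f x) (unzip2 (take (l * i) q)).
pose k := (L %/ l)%N.
pose near i e := exists v, v \in ends e /\ (gdist (f v) (u i) <= c)%N.
have dist_near i v v' : (gdist (f v) (u i) <= c)%N -> (gdist (f v') (u i) <= c)%N ->
    (gdist v v' <= c * (c + c + c))%N.
  move=> vi v'i; rewrite (leq_trans (fexp v v')) // leq_mul // leq_add2r.
  rewrite (leq_trans (gdist_triangle connH (u i) _ _)) // leq_add //.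
  by rewrite gdist_sym.
have /choice[F FP] i : exists F : {fset edge G}, (#|` F| <= N)%N /\
    forall e, e \in F <-> near i e /\ (i < k)%N.
  (* All the vertices near [u i] lie in one ball around any of them, [v0]. *)
  have [[v0 v0i]|none] := pselect (exists v0, (gdist (f v0) (u i) <= c)%N); last first.
    exists fset0; split; first by rewrite cardfs0.
    by move=> e; split=> // -[[v [_ vi]] _]; case: none; exists v.
  have [s [sN sP]] := ball v0.
  exists [fset e in [seq e <- s | `[< near i e >] && (i < k)%N]]%fset; split.
    rewrite card_fseq (leq_trans (size_undup _)) // (leq_trans _ sN) // size_filter.
    exact: count_size.
  move=> e; rewrite inE /= mem_filter; split.
    by move=> /andP[/andP[/asboolP]].
  move=> [[v [ve vi]] ik]; rewrite ik andbT; apply/andP; split.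
    by apply/asboolP; exists v.
  have [p v0v sp] := gdist_path connG v0 v.
  by apply: sP v0v _ ve; rewrite sp (dist_near i).
have kL i : (i < k)%N -> (l * i <= L)%N.
  by move=> ik; rewrite mulnC (leq_trans _ (leq_trunc_div L l)) // leq_mul2r ltnW ?orbT.
have Lc : (gdist x y <= c * (L + c))%N by rewrite sq; exact: fexp.
exists k, F; split.
- have l0 : (0 < l)%N by [].
  have lL : (l <= L)%N.
    by rewrite leqNgt; apply/negP => Ll; move: (leq_trans xy Lc); rewrite ltn_mul2l; lia.
  have k0 : (0 < k)%N by rewrite divn_gt0.
  have : (L <= l * k.+1)%N by rewrite ltnW // mulnC ltn_ceil.
  nia.
- by move=> i; case: (FP i).
- move=> i j e /(FP i).2 [[v [ve vi]] ik] /(FP j).2 [[v' [v'e v'j]] jk].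
  wlog ij : i j v v' ve vi ik v'e v'j jk / (i <= j)%N.
    move=> W; have [ij|/ltnW ji] := leqP i j; first exact: (W i j v v').
    by rewrite (W j i v' v).
  have := geodesic_separation connH (l * i) fq sq (kL _ jk).
  rewrite -/(u i) -/(u j) => sep.
  have : (gdist (u i) (u j) <= c + (c + c))%N.
    rewrite (leq_trans (gdist_triangle connH (f v) _ _)) // leq_add //.
      by rewrite gdist_sym.
    rewrite (leq_trans (gdist_triangle connH (f v') _ _)) // leq_add // fLip //.
    exact: gdist_edge_vertices ve v'e.
  nia.
- move=> s [p /andP[xp sap] <-] i ik.
  have uq : u i \in f x :: unzip2 q.
    have := mem_last (f x) (unzip2 (take (l * i) q)); rewrite -/(u i) !inE.
    case/predU1P => [->|]; rewrite ?eqxx // /unzip2 map_take => /mem_take ->.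
    by rewrite orbT.
  have [v vp vi] := paths_pass_near_tree_geodesic connG connH acyclicH fLip fq saq uq xp.
  have [|e ep ve] := edge_at_path_vertex xp _ vp.
    by apply: contraTneq xy => p0; move: xp; rewrite p0 => /= /eqP ->; rewrite gdist0.
  by exists e; rewrite ?inE //; apply/(FP i).2; split => //; exists v.
Qed.

(** * Disjoint edge sets along a path *)

(** Each good [F i] has an edge of its own in [s], by disjointness, and there
    [phi] is at least [delta]. *)
Lemma disjoint_family_sum_le (E : choiceType) (R : realType)
    (F : nat -> {fset E}) (k : nat) (s : {fset E}) (phi : E -> R) (delta : R)
    (good : pred nat) :
  (forall i j e, e \in F i -> e \in F j -> i = j) ->
  (forall i, (i < k)%N -> exists2 e, e \in F i & e \in s) ->
  (forall e, 0 <= phi e) ->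
  (forall i, good i -> forall e, e \in F i -> delta <= phi e) ->
  delta * \sum_(i < k) (good i)%:R <= \sum_(e <- s) phi e.
Proof.
move=> disjF meetF phi0 goodF.
rewrite mulr_sumr.
have le1 (i : 'I_k) :
    delta * (good i)%:R <= \sum_(e <- s) (if e \in F i then phi e else 0).
  have sum0 (r : seq E) (Q : pred E) :
      0 <= \sum_(e <- r | Q e) (if e \in F i then phi e else 0).
    by apply: sumr_ge0 => e _; case: ifP.
  case: (boolP (good i)) => [gi|_]; last by rewrite mulr0.
  have [e eF es] := meetF i (ltn_ord i).
  rewrite mulr1 (bigD1_seq e) //= eF (le_trans (goodF i gi e eF)) // lerDl.
  exact: sum0.
rewrite (le_trans (ler_sum _ (fun i _ => le1 i))) // exchange_big /=.
apply: ler_sum => e _; rewrite -big_mkcond /=.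
have [[i ei]|none] := pselect (exists i : 'I_k, e \in F i).
  rewrite (big_pred1 i) // => j; apply/idP/eqP => [ej|-> //].
  exact/val_inj/(disjF _ _ e).
rewrite big_pred0 // => i; apply/negP => ei; apply: none; by exists i.
Qed.

(** * Independent families and their joint law *)

Section ProductLaw.
Context {R : realType} {I : choiceType}.

(** Independence with common law [P0], for an arbitrary state space and one
    finite index set, so that it applies to the edge weights as well as to
    independent copies of a coupling. *)
Definition product_law (d d0 : measure_display) (Omega : measurableType d)
    (P : probability Omega R) (Omega0 : measurableType d0)
    (P0 : set Omega0 -> \bar R) (J : {fset I})
    (X : I -> Omega -> Omega0) : Prop :=
  forall A : I -> set Omega0, (forall i, measurable (A i)) ->
    P (\bigcap_(i in [set` J]) X i @^-1` A i) = (\prod_(i <- J) P0 (A i))%E.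

(** The events at the indices outside [K] are taken to be trivial. *)
Lemma product_lawS (d d0 : measure_display) (Omega : measurableType d)
    (P : probability Omega R) (Omega0 : measurableType d0)
    (P0 : probability Omega0 R) (J K : {fset I}) (X : I -> Omega -> Omega0) :
  (K `<=` J)%fset -> product_law P P0 J X -> product_law P P0 K X.
Proof.
move=> KJ lawJ A mA.
pose A' i := if i \in K then A i else setT.
have mA' i : measurable (A' i) by rewrite /A'; case: ifP.
have -> : \bigcap_(i in [set` K]) X i @^-1` A i =
          \bigcap_(i in [set` J]) X i @^-1` A' i.
  apply/seteqP; split=> t h i /= iK.
    by rewrite /A'; case: ifP => // iK'; exact: h.
  by have := h i (fsubsetP KJ i iK); rewrite /A' /= iK.
rewrite lawJ // [RHS](@eq_big_seq _ _ _ _ _ _ (fun i => P0 (A' i))).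
  apply/esym/(big_fset_incl _ KJ) => i _ /negPf iK.
  by rewrite /A' iK probability_setT.
by move=> i iK; rewrite /A' iK.
Qed.

Lemma product_law_ge (d d0 : measure_display) (Omega : measurableType d)
    (P : probability Omega R) (Omega0 : measurableType d0)
    (P0 : probability Omega0 R) (J : {fset I}) (X : I -> Omega -> Omega0)
    (B : set Omega0) (N : nat) :
  measurable B -> product_law P P0 J X -> (#|` J| <= N)%N ->
  ((fine (P0 B) ^+ N)%:E <= P (\bigcap_(i in [set` J]) X i @^-1` B))%E.
Proof.
move=> mB lawJ JN; rewrite (lawJ (fun=> B)) //.
have pE : P0 B = (fine (P0 B))%:E by rewrite fineK // fin_num_measure.
have p0 : 0 <= fine (P0 B) by rewrite fine_ge0.
have p1 : fine (P0 B) <= 1 by rewrite -lee_fin -pE probability_le1.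
rewrite pE prodEFin lee_fin big_const_seq count_predT iter_mulr_1.
exact: ler_wiXn2l.
Qed.

(** The space is an iterated product, one factor for each index; the remaining
    indices get a copy that is not independent of the others. *)
Lemma iid_copies_exist (d0 : measure_display) (Omega0 : measurableType d0)
    (P0 : probability Omega0 R) (J : {fset I}) :
  exists (d : measure_display) (Omega : measurableType d)
    (P : probability Omega R) (Z : I -> Omega -> Omega0),
    (forall i, measurable_fun setT (Z i)) /\ product_law P P0 J Z.
Proof.
suff : forall s : seq I, uniq s -> exists (d : measure_display)
    (Omega : measurableType d) (P : probability Omega R)
    (Z : I -> Omega -> Omega0),
    (forall i, measurable_fun setT (Z i)) /\
    forall A : I -> set Omega0, (forall i, measurable (A i)) ->
    P (\bigcap_(i in [set` s]) Z i @^-1` A i) = (\prod_(i <- s) P0 (A i))%E.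
  by move=> /(_ _ (fset_uniq J)).
elim=> [_|i s IH].
  exists d0, Omega0, P0, (fun=> id); split=> [i|A mA]; first exact: measurable_id.
  rewrite big_nil (_ : \bigcap_(i in _) _ = setT) ?probability_setT //.
  apply/seteqP; split=> // t _ j; rewrite /= in_nil.
move=> /= /andP[iNs us]; case: (IH us) => d [T [P [Z [mZ lawZ]]]].
exists _, (Omega0 * T)%type, (P0 \x P)%E,
  (fun j => if j == i then fst else Z j \o snd); split=> [j|A mA].
  case: ifP => _; first exact: measurable_fst.
  by apply: measurableT_comp => //; exact: measurable_snd.
rewrite big_cons -lawZ // -product_measure1E //.
  congr ((P0 \x P)%E _); apply/seteqP; split=> -[a b] /= h.
    split.
      by have /= := h i; rewrite eqxx; apply; rewrite /= inE eqxx.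
    move=> j /= js; have := h j; rewrite (negPf (memPn iNs _ js)) /=; apply.
    by rewrite inE js orbT.
  move=> j /=; rewrite inE; case: eqP => [-> _|_ /= js]; first exact: h.1.
  exact: (h.2 j js).
apply: fin_bigcap_measurable => // j _.
by rewrite -[X in measurable X]setTI; exact: mZ.
Qed.

End ProductLaw.

(** The function space is named so that it can be made a pointed type, as is
    required of the carrier of a generated sigma-algebra. *)
Definition config (R : realType) (I : choiceType) := I -> R.
HB.instance Definition _ R I := Choice.copy (config R I) (I -> R).
HB.instance Definition _ R I := isPointed.Build (config R I) (fun=> 0).

Section JointLaw.
Context {R : realType} {I : choiceType}.

Definition cylinders (J : {fset I}) : set (set (config R I)) :=
  [set C | exists2 A : I -> set R, (forall i, measurable (A i)) &
           C = [set f | forall i, i \in J -> A i (f i)]].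

Local Notation cylinder_space J := (g_sigma_algebraType (cylinders J)).

Lemma measurable_coordinate (J : {fset I}) (i : I) : i \in J ->
  measurable_fun setT ((fun f => f i) : cylinder_space J -> R).
Proof.
move=> iJ _ B mB; rewrite setTI; apply: sub_sigma_algebra.
exists (fun j => if j == i then B else setT) => [j|]; first by case: ifP.
apply/seteqP; split=> f /= Bf.
  by move=> j _; case: eqP => // ->.
by have := Bf i iJ; rewrite eqxx.
Qed.

Lemma measurable_sample (J : {fset I}) (d : measure_display)
    (T : measurableType d) (X : I -> T -> R) :
  (forall i, measurable_fun setT (X i)) ->
  measurable_fun setT ((fun t i => X i t) : T -> cylinder_space J).
Proof.
move=> mX.
apply: (@measurability _ _ T (cylinder_space J) setT _ (cylinders J)) => //.
move=> _ [_ [A mA ->] <-].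
rewrite setTI (_ : _ @^-1` _ = \bigcap_(i in [set` J]) X i @^-1` A i) //.
apply: fin_bigcap_measurable => // i _.
by rewrite -[X in measurable X]setTI; exact: mX.
Qed.

(** Cylinders over [J] are stable under intersection, so the joint law of the
    family on the sigma-algebra they generate is determined by its values on
    them.  This is what allows one to change the probability space. *)
Lemma product_law_integral (nu : set R -> \bar R) (J : {fset I})
    (d1 d2 : measure_display) (T1 : measurableType d1) (T2 : measurableType d2)
    (P1 : probability T1 R) (P2 : probability T2 R)
    (X1 : I -> T1 -> R) (X2 : I -> T2 -> R) (Phi : (I -> R) -> \bar R) :
  (forall i, measurable_fun setT (X1 i)) ->
  (forall i, measurable_fun setT (X2 i)) ->
  @product_law R I _ _ _ P1 (measurableTypeR R) nu J X1 ->
  @product_law R I _ _ _ P2 (measurableTypeR R) nu J X2 ->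
  @measurable_fun _ _ (cylinder_space J) (\bar R) setT Phi ->
  (forall f, 0 <= Phi f)%E ->
  (\int[P1]_t Phi (fun i => X1 i t) = \int[P2]_t Phi (fun i => X2 i t))%E.
Proof.
move=> mX1 mX2 law1 law2 mPhi Phi0.
have mS1 := measurable_sample (J := J) mX1; have mS2 := measurable_sample (J := J) mX2.
pose S1 : {mfun T1 >-> cylinder_space J} :=
  HB.pack (fun t i => X1 i t) (isMeasurableFun.Build _ _ _ _ _ mS1).
pose S2 : {mfun T2 >-> cylinder_space J} :=
  HB.pack (fun t i => X2 i t) (isMeasurableFun.Build _ _ _ _ _ mS2).
have eqlaw : forall A, measurable A -> distribution P1 S1 A = distribution P2 S2 A.
  move=> A mA; apply: (@measure_unique _ R (cylinder_space J) (cylinders J)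
    (fun=> setT) _ _ _ _ (distribution P1 S1) (distribution P2 S2)).
  - by [].
  - move=> _ _ [A1 mA1 ->] [A2 mA2 ->].
    exists (fun i => A1 i `&` A2 i) => [i|]; first exact: measurableI.
    apply/seteqP; split=> f /=; first by move=> [f1 f2] i iJ; split; auto.
    by move=> f12; split=> i iJ; have [] := f12 i iJ.
  - move=> _; exists (fun=> setT) => //.
    by apply/seteqP; split.
  - by rewrite bigcup_const.
  - move=> _ [B mB ->].
    change (P1 (\bigcap_(i in [set` J]) X1 i @^-1` B i) =
            P2 (\bigcap_(i in [set` J]) X2 i @^-1` B i)).
    by rewrite law1 // law2.
  - move=> _; rewrite /= /distribution /pushforward.
    by rewrite preimage_setT probability_setT ltry.
  - exact: mA.
rewrite -(ge0_integral_distribution S1 mPhi) //.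
rewrite -(ge0_integral_distribution S2 mPhi) //.
by apply: eq_measure_integral => A mA _; exact: eqlaw.
Qed.

End JointLaw.

(** * Minima over finitely many paths *)

Section BestTime.
Context {R : realType} {G : multigraph}.
Local Notation cylinder_space J := (g_sigma_algebraType (cylinders (R := R) J)).
Implicit Types (s : {fset edge G}) (ss : seq {fset edge G}).

(** The path [s0] is kept apart so that the minimum is over a nonempty family. *)
Definition best_time (s0 : {fset edge G}) ss (w : edge G -> R) : R :=
  \big[Num.min/path_time w s0]_(s <- ss) path_time w s.

Lemma path_time_ge0 (w : edge G -> R) s : (forall e, 0 <= w e) -> 0 <= path_time w s.
Proof. by move=> w0; apply: sumr_ge0. Qed.

Lemma best_time_ge (s0 : {fset edge G}) ss (w : edge G -> R) b :
  (forall s, s \in s0 :: ss -> b <= path_time w s) -> b <= best_time s0 ss w.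
Proof.
rewrite /best_time; elim: ss => [|s ss IH] H; first by rewrite big_nil H ?inE.
rewrite big_cons le_min H ?inE ?eqxx ?orbT //= IH // => s'.
by rewrite inE => /predU1P[->|s's]; apply: H; rewrite !inE ?eqxx ?s's ?orbT.
Qed.

Lemma best_time_le (s0 : {fset edge G}) ss (w : edge G -> R) s :
  s \in s0 :: ss -> best_time s0 ss w <= path_time w s.
Proof.
rewrite /best_time; elim: ss => [|s1 ss IH].
  by rewrite big_nil inE => /eqP ->.
rewrite big_cons ge_min => sss; case: (eqVneq s s1) => [->|ss1].
  by rewrite lexx.
by rewrite IH ?orbT //; move: sss; rewrite !inE (negPf ss1).
Qed.

Lemma measurable_path_time (J s : {fset edge G}) : (s `<=` J)%fset ->
  measurable_fun setT ((fun w => path_time w s) : cylinder_space J -> R).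
Proof.
move=> sJ; rewrite (_ : (fun w => path_time w s) =
    fun w => \sum_(e <- s) (if e \in J then w e else 0)).
  apply: measurable_sum => e; case: (boolP (e \in J)) => eJ.
    exact: measurable_coordinate.
  exact: measurable_cst.
apply/funext => w; apply: eq_big_seq => e es.
by rewrite (fsubsetP sJ e es).
Qed.

Lemma measurable_best_time (J s0 : {fset edge G}) ss :
  (forall s, s \in s0 :: ss -> (s `<=` J)%fset) ->
  measurable_fun setT (best_time s0 ss : cylinder_space J -> R).
Proof.
rewrite /best_time; elim: ss => [|s ss IH] sJ.
  under eq_fun do rewrite big_nil.
  by apply: measurable_path_time; apply: sJ; rewrite inE.
under eq_fun do rewrite big_cons.
apply: measurable_minr.
  by apply: measurable_path_time; apply: sJ; rewrite !inE eqxx orbT.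
apply: IH => s'; rewrite inE => /predU1P[->|s's]; apply: sJ.
  by rewrite inE eqxx.
by rewrite !inE s's !orbT.
Qed.

End BestTime.

(** * Enumeration of paths *)

Section PathEnumeration.
Variable G : multigraph.

Lemma countable_edge_sets : ambient_graph G -> countable [set: {fset edge G}].
Proof.
move=> [_ locfin cardV].
have /countable_injP[f finj] : countable [set: edge G].
  rewrite (_ : setT = \bigcup_(x in [set: vertex G]) incident x).
    apply: bigcup_countable => [|x _]; last exact/finite_set_countable/locfin.
    by rewrite (eq_countable cardV).
  apply/seteqP; split=> // e _.
  have [e0|[x xe]] := fset_0Vmem (ends e).
    by have := card_ends e; rewrite e0 cardfs0.
  by exists x.
have {}finj : injective f by move=> x y fxy; apply: finj; rewrite ?inE.
apply/countable_injP; exists (fun s => choice.pickle (map f (enum_fset s))).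
by move=> s t _ _ /(pcan_inj choice.pickleK)/(inj_map finj)/val_inj.
Qed.

Lemma sa_paths_nonempty (x y : vertex G) :
  connected_graph G -> sa_paths x y !=set0.
Proof.
move=> connG; have [p xp] := connG x y; have [q [xq saq _ _]] := loop_erasure xp.
by exists [fset e in unzip1 q]%fset; exists q => //=; rewrite xq.
Qed.

(** Paths are finite sets of edges, and there are countably many edges. *)
Lemma sa_paths_enumeration (x y : vertex G) : ambient_graph G ->
  exists S : nat -> {fset edge G}, range S = sa_paths x y.
Proof.
move=> HG; have [connG _ _] := HG.
have [s0 s0P] := sa_paths_nonempty x y connG.
have /countable_injP[f finj] := countable_edge_sets HG.
have {}finj : injective f by move=> a b fab; apply: finj; rewrite ?inE.
pose S n := xget s0 [set s | sa_paths x y s /\ f s = n].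
exists S; apply/seteqP; split=> [_ [n _ <-]|s sP].
  by rewrite /S; case: xgetP => // s _ [].
exists (f s) => //; apply: finj; rewrite /S; case: xgetP => [t _ [_ //]|].
by move=> /(_ s)[].
Qed.

End PathEnumeration.

(** * Couplings with a gap *)

Section Coupling.
Context {R : realType}.
Implicit Types nu : probability (measurableTypeR R) R.

Lemma eq_law_ae (d : measure_display) (T : measurableType d)
    (P : probability T R) (X Y : {RV P >-> R}) nu :
  {ae P, forall t, Y t = X t} -> has_law X nu -> has_law Y nu.
Proof.
move=> [N [mN N0 subN]] lawX A mA; rewrite -lawX // /distribution /pushforward.
have mXA : measurable (X @^-1` A).
  by rewrite -[X in measurable X]setTI; exact: measurable_funP.
have mYA : measurable (Y @^-1` A).
  by rewrite -[X in measurable X]setTI; exact: measurable_funP.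
have XY t : ~ N t -> Y t = X t.
  by move=> Nt; apply: contrapT => YXt; apply/Nt/subN.
have PE B : measurable B -> P B = P (B `\` N).
  move=> mB; have BN0 : P (B `&` N) = 0%E.
    apply: measure_negligible; first exact: measurableI.
    by exists N; split=> //; exact: subIsetr.
  rewrite -(measureU0 (measurableD mB mN) (measurableI _ _ mB mN) BN0).
  by rewrite setUC setUIDK.
rewrite (PE _ mYA) (PE _ mXA); congr (P _).
by apply/seteqP; split=> t [] /= At Nt; split=> //; move: At; rewrite XY.
Qed.

Lemma prob_nonneg_ae (d : measure_display) (T : measurableType d)
    (P : probability T R) (X : {RV P >-> R}) nu :
  prob_nonneg nu -> has_law X nu -> {ae P, forall t, 0 <= X t}.
Proof.
move=> nu0 lawX; exists (X @^-1` `]-oo, 0[%classic); split.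
- by rewrite -[X in measurable X]setTI; apply: measurable_funP.
- have := lawX `]-oo, 0[%classic (measurable_itv _).
  rewrite /distribution /pushforward => ->.
  have -> : `]-oo, 0[%classic = ~` `[0, +oo[%classic :> set R by rewrite setCitvr.
  by rewrite probability_setC ?nu0 ?subee.
- by move=> t /= /negP; rewrite -ltNge in_itv.
Qed.

Definition RV_of (d : measure_display) (T : measurableType d)
    (P : probability T R) (f : T -> R) (mf : measurable_fun setT f) :
  {RV P >-> R} := HB.pack f (isMeasurableFun.Build _ _ _ _ f mf).

Lemma measurable_gap (d : measure_display) (T : measurableType d)
    (P : probability T R) (X' X : {RV P >-> R}) (delta : R) :
  measurable [set t | delta <= X t - X' t].
Proof.
have mXX : measurable_fun setT (fun t => X t - X' t) by exact: measurable_funB.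
have := mXX measurableT _ (measurable_itv `[delta, +oo[).
rewrite setTI (_ : _ @^-1` _ = [set t | delta <= X t - X' t]) //.
by apply/seteqP; split=> t /=; rewrite in_itv /= andbT.
Qed.

(** Changing the coupling on a null set makes the domination hold everywhere.
    If the gap [X - X'] were almost surely less than every [n.+1%:R^-1], then
    [X'] and [X] would be almost surely equal, and their laws equal. *)
Lemma strict_coupling nu nu' :
  prob_nonneg nu -> prob_nonneg nu' -> strictly_dominates nu nu' ->
  exists (d : measure_display) (T : measurableType d) (P : probability T R)
      (X' X : {RV P >-> R}) (delta : R),
    [/\ has_law X' nu', has_law X nu, forall t, 0 <= X' t <= X t,
        0 < delta & (0 < P [set t | (delta <= X t - X' t)%R])%E].
Proof.
move=> nu0 nu'0 [[A [mA nuA]]].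
move=> [d [T [P [Y' [Y [lawY' lawY YY']]]]]].
have mX' : measurable_fun setT (fun t => Num.max 0 (Y' t)).
  by apply: measurable_maxr => //; exact: measurable_cst.
pose X' := RV_of P mX'.
have mX : measurable_fun setT (fun t => Num.max (X' t) (Y t)).
  exact: measurable_maxr.
pose X := RV_of P mX.
have lawX' : has_law X' nu'.
  apply: (eq_law_ae _ lawY'); apply: filterS (prob_nonneg_ae nu'0 lawY') => t Yt.
  by rewrite /X' /=; apply/max_idPr.
have lawX : has_law X nu.
  apply: (eq_law_ae _ lawY).
  apply: filterS2 YY' (prob_nonneg_ae nu0 lawY) => t Y'Y Yt.
  by rewrite /X /=; apply/max_idPr; rewrite /X' /= ge_max Yt.
have X'X t : 0 <= X' t <= X t.
  by apply/andP; split; rewrite [leRHS]/= le_max lexx.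
suff [n Pn] : exists n : nat, (0 < P [set t | (n.+1%:R^-1 <= X t - X' t)%R])%E.
  by exists d, T, P, X', X, n.+1%:R^-1; split.
apply: contrapT => Pn0; apply: nuA; rewrite -lawX //; apply/esym.
apply: (eq_law_ae _ lawX') => //.
exists (\bigcup_n [set t | n.+1%:R^-1 <= X t - X' t]).
have mB n : measurable [set t | n.+1%:R^-1 <= X t - X' t] by exact: measurable_gap.
split.
- exact: bigcup_measurable.
- have -> // : P (\bigcup_n [set t | n.+1%:R^-1 <= X t - X' t]) = 0%E.
  apply: measure_negligible; first exact: bigcup_measurable.
  apply: negligible_bigcup => n; apply/negligibleP => //.
  apply/eqP; rewrite eq_le measure_ge0 andbT leNgt; apply/negP => Bn.
  by apply: Pn0; exists n.
- move=> t /= XX'; have gap : 0 < X t - X' t.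
    have /andP[_] := X'X t; rewrite le_eqVlt subr_gt0 => /predU1P[e|//].
    by case: XX'; exact/esym.
  exists (Num.truncn (X t - X' t)^-1) => //=.
  by rewrite invf_ple ?posrE // ltW // truncnS_gt.
Qed.

End Coupling.

(** * Lower bounds for integrals *)

Section Integrals.
Context {R : realType}.

(** The integral of a nonnegative function is a supremum over the simple
    functions below it, whether or not it is measurable.  This dispenses with
    the measurability of the geodesic as a function of the weights. *)
Lemma ge0_le_integral_nonmeasurable (d : measure_display) (T : measurableType d)
    (mu : {measure set T -> \bar R}) (f g : T -> \bar R) :
  (forall t, 0 <= g t)%E -> (forall t, g t <= f t)%E ->
  (\int[mu]_t g t <= \int[mu]_t f t)%E.
Proof.
move=> g0 gf; have f0 t : (0 <= f t)%E by exact: le_trans (gf t).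
rewrite !ge0_integralTE //; apply: le_ereal_sup => _ [h hg <-].
by exists h => // t; exact: le_trans (gf t).
Qed.

(** The null set where the inequality may fail is removed from the events. *)
Lemma integral_ge_sum_events (d : measure_display) (T : measurableType d)
    (P : probability T R) (B : nat -> set T) (k : nat) (delta q : R)
    (f : T -> R) :
  0 <= delta -> (forall i, (i < k)%N -> measurable (B i)) ->
  (forall i, (i < k)%N -> (q%:E <= P (B i))%E) -> (forall t, 0 <= f t) ->
  {ae P, forall t, delta * \sum_(i < k) (t \in B i)%:R <= f t} ->
  ((delta * k%:R * q)%:E <= \int[P]_t (f t)%:E)%E.
Proof.
move=> d0 mB qB f0 [N [mN N0 subN]].
have mBN (i : 'I_k) : measurable (B i `\` N) by apply: measurableD => //; exact: mB.
pose g t : \bar R := (\sum_(i < k) (delta%:E * (\1_(B i `\` N) t)%:E))%E.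
have gE t : g t = (delta * \sum_(i < k) \1_(B i `\` N) t)%:E.
  by rewrite mulr_sumr -sumEFin; apply: eq_bigr => i _; rewrite EFinM.
have ind0 (i : 'I_k) t : 0 <= \1_(B i `\` N) t :> R by rewrite indicE ler0n.
apply: (@le_trans _ _ (\int[P]_t g t)%E); last first.
  apply: ge0_le_integral_nonmeasurable => t; rewrite gE lee_fin.
    by rewrite mulr_ge0 // sumr_ge0.
  have [Nt|Nt] := pselect (N t).
    rewrite big1 ?mulr0 // => i _; rewrite indicE memNset //.
    by case.
  apply: (@le_trans _ _ (delta * \sum_(i < k) (t \in B i)%:R)); last first.
    by apply: contrapT => h; apply/Nt/subN.
  apply: ler_wpM2l => //; apply: ler_sum => i _; rewrite indicE ler_nat.
  case: (boolP (t \in _ `\` _)) => //= /set_mem[Bt _].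
  by rewrite mem_set.
rewrite ge0_integral_sum //; last 2 first.
- move=> i; apply/measurable_EFinP; exact: measurable_funM.
- by move=> i t _; rewrite -EFinM lee_fin; apply: mulr_ge0; [exact: d0|exact: ind0].
rewrite (_ : delta * k%:R * q = \sum_(i < k) (delta * q)); last first.
  by rewrite sumr_const card_ord -[RHS]mulr_natr mulrAC.
rewrite -sumEFin; apply: lee_sum => i _.
rewrite ge0_integralZl //; last exact/measurable_EFinP/measurable_indic.
rewrite integral_indic // setIT EFinM lee_wpmul2l ?lee_fin //.
apply: le_trans (qB i (ltn_ord i)) _.
rewrite (_ : P (B i) = P ((B i `\` N) `|` (B i `&` N))); last first.
  by rewrite setUC setUIDK.
rewrite measureU0 //; first by apply: measurableI => //; exact: mB.
apply: measure_negligible; first by apply: measurableI => //; exact: mB.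
by exists N; split=> //; exact: subIsetr.
Qed.

Lemma integral_law (d : measure_display) (T : measurableType d)
    (P : probability T R) (X : {RV P >-> R})
    (nu : probability (measurableTypeR R) R) :
  has_law X nu -> finite_mean nu -> P.-integrable setT (EFin \o X).
Proof.
move=> lawX /integrableP[_ mean]; apply/integrableP; split.
  exact/measurable_EFinP.
(* [nu] lives on the Lebesgue-Stieltjes copy of the line, which has the same
   Borel sets. *)
have mX : @measurable_fun _ _ T (measurableTypeR R) setT X.
  by have := measurable_funPT X.
pose Y : {mfun T >-> measurableTypeR R} :=
  HB.pack (X : T -> measurableTypeR R) (isMeasurableFun.Build _ _ _ _ _ mX).
have eqI : (\int[distribution P Y]_r `|r%:E| = \int[nu]_r `|r%:E|)%E.
  by apply: eq_measure_integral => A mA _; exact: lawX.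
rewrite -eqI ge0_integral_distribution // in mean.
by apply: measurableT_comp => //; exact/measurable_EFinP.
Qed.

End Integrals.

(** * Passage times as limits of finite minima *)

Section PassageTimes.
Context {R : realType} {G : multigraph}.
Local Notation E := (edge G).
Variables (x y : vertex G) (S : nat -> {fset E}).
Hypothesis rangeS : range S = sa_paths x y.

Lemma sa_path_enumerated n : sa_paths x y (S n).
Proof. by rewrite -rangeS; exists n. Qed.

Lemma has_lbound_path_times (w : E -> R) : (forall e, 0 <= w e) ->
  has_lbound [set path_time w s | s in sa_paths x y].
Proof. by move=> w0; exists 0 => _ [s _ <-]; exact: path_time_ge0. Qed.

Lemma path_times_nonempty (w : E -> R) :
  [set path_time w s | s in sa_paths x y] !=set0.
Proof.
by exists (path_time w (S 0%N)), (S 0%N) => //; exact: sa_path_enumerated.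
Qed.

Lemma passage_time_ge0 (w : E -> R) :
  (forall e, 0 <= w e) -> 0 <= passage_time w x y.
Proof.
move=> w0; apply: lb_le_inf => [|_ [s _ <-]]; last exact: path_time_ge0.
exact: path_times_nonempty.
Qed.

Lemma passage_time_le_best_time (w : E -> R) n : (forall e, 0 <= w e) ->
  passage_time w x y <= best_time (S 0%N) (mkseq S n) w.
Proof.
move=> w0; apply: best_time_ge => s sS.
apply: ge_inf; first exact: has_lbound_path_times.
by exists s => //; move: sS; rewrite inE => /predU1P[->|/mapP[i _ ->]];
  exact: sa_path_enumerated.
Qed.

(** The minimum over the first [n] paths decreases to the infimum. *)
Lemma best_time_cvg (w : E -> R) : (forall e, 0 <= w e) ->
  best_time (S 0%N) (mkseq S n) w @[n --> \oo] --> passage_time w x y.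
Proof.
move=> w0; pose u n := best_time (S 0%N) (mkseq S n) w.
have u_le n m : (n < m)%N -> u m <= path_time w (S n).
  move=> nm; apply: best_time_le; rewrite inE; apply/orP; right.
  by apply/mapP; exists n; rewrite // mem_iota.
have le_u b n : (forall i, b <= path_time w (S i)) -> b <= u n.
  move=> bS; apply: best_time_ge => s; rewrite inE => /predU1P[->//|].
  by move=> /mapP[i _ ->].
have noninc : nonincreasing_seq u.
  apply/nonincreasing_seqP => n; apply: best_time_ge => s sn.
  apply: best_time_le; move: sn; rewrite inE => /predU1P[->|/mapP[i]].
    by rewrite inE eqxx.
  rewrite mem_iota => /andP[_ ni] ->; rewrite inE; apply/orP; right.
  by apply/mapP; exists i => //; rewrite mem_iota /= (leq_trans ni).
have lb : has_lbound (range u).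
  by exists 0 => _ [n _ <-]; apply: le_u => i; exact: path_time_ge0.
rewrite (_ : passage_time w x y = inf (range u)); first exact: nonincreasing_cvgn.
apply/eqP; rewrite eq_le; apply/andP; split.
  apply: lb_le_inf => [|_ [n _ <-]]; first by exists (u 0%N), 0%N.
  exact: passage_time_le_best_time.
apply: lb_le_inf; first exact: path_times_nonempty.
move=> _ [s + <-]; rewrite -rangeS => -[n _ <-].
by apply: le_trans (u_le n n.+1 _) => //; apply: ge_inf => //; exists n.+1.
Qed.

Variables (d : measure_display) (T : measurableType d) (P : probability T R).
Variables (nu : probability (measurableTypeR R) R) (w : E -> {RV P >-> R}).
Hypotheses (Hw : iid_weights nu w) (mean : finite_mean nu).

Lemma measurable_path_time_RV s :
  measurable_fun setT (fun t => path_time (fun e => w e t) s).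
Proof. by apply: measurable_sum => e; exact: measurable_funP. Qed.

Lemma measurable_best_time_RV s0 ss :
  measurable_fun setT (fun t => best_time s0 ss (fun e => w e t)).
Proof.
rewrite /best_time; elim: ss => [|s ss IH].
  by under eq_fun do rewrite big_nil; exact: measurable_path_time_RV.
under eq_fun do rewrite big_cons.
by apply: measurable_minr => //; exact: measurable_path_time_RV.
Qed.

Lemma integrable_path_time s :
  P.-integrable setT (fun t => (path_time (fun e => w e t) s)%:E).
Proof.
have [_ lawW _] := Hw.
rewrite (_ : (fun t => _) = (fun t => \sum_(e <- s) (w e t)%:E)%E).
  by apply: integrable_sum => // e _; exact: integral_law (lawW e) mean.
by apply/funext => t; rewrite /path_time -sumEFin.
Qed.

(** All the minima lie between [0] and the time of the path [S 0], which is
    integrable because the weights have finite mean. *)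
Lemma expected_best_time_cvg :
  P.-integrable setT (fun t => (passage_time (fun e => w e t) x y)%:E) /\
  (\int[P]_t (best_time (S 0%N) (mkseq S n) (fun e => w e t))%:E)%E
     @[n --> \oo] --> (\int[P]_t (passage_time (fun e => w e t) x y)%:E)%E.
Proof.
have [w0 _ _] := Hw.
have cvgT t : best_time (S 0%N) (mkseq S n) (fun e => w e t) @[n --> \oo] -->
    passage_time (fun e => w e t) x y by apply: best_time_cvg.
have mT : measurable_fun setT (fun t => passage_time (fun e => w e t) x y).
  by apply: (measurable_fun_cvg
    (fun n => measurable_best_time_RV (S 0%N) (mkseq S n))).
have [] := @dominated_convergence _ T R P setT measurableT
  (fun n t => (best_time (S 0%N) (mkseq S n) (fun e => w e t))%:E)
  (fun t => (passage_time (fun e => w e t) x y)%:E)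
  (fun t => (path_time (fun e => w e t) (S 0%N))%:E).
- by move=> n; exact/measurable_EFinP/measurable_best_time_RV.
- exact/measurable_EFinP.
- by apply: aeW => t _; apply: cvg_EFin; [exact: nearW|exact: cvgT].
- exact: integrable_path_time.
- apply: aeW => t n _ /=; rewrite lee_fin ger0_norm.
    by apply: best_time_le; rewrite inE eqxx.
  by apply: best_time_ge => s _; exact: path_time_ge0.
- by move=> iT _ cvg; split.
Qed.

End PassageTimes.

(** * From linear bounds to the lower limit *)

Section Liminf.
Context {R : realType} {G : multigraph}.

Lemma liminf_dist_gt0 (f : vertex G -> vertex G -> \bar R) (c : R) (n0 : nat) :
  0 < c -> (forall x y, (n0 <= gdist x y)%N -> (c%:E <= f x y)%E) ->
  (0 < liminf_dist f)%E.
Proof.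
move=> c0 fc; apply: (@lt_le_trans _ _ c%:E); first by rewrite lte_fin.
apply: ereal_sup_ge; eexists; first by exists n0.
by apply: le_ereal_inf_tmp => _ [[x y] /= xy <-]; exact: fc.
Qed.

Lemma linear_lower_bound (M k d : nat) (delta q : R) (a : \bar R) :
  0 <= delta -> 0 <= q -> (0 < d <= M * k)%N ->
  ((delta * k%:R * q)%:E <= a)%E ->
  ((delta * q / M%:R)%:E <= a / d%:R%:E)%E.
Proof.
move=> delta0 q0 /andP[d0 dMk] ka; have d0R : 0 < d%:R :> R by rewrite ltr0n.
have M0 : 0 < M%:R :> R by rewrite ltr0n; case: (M) dMk => //; lia.
rewrite inver gt_eqF // lee_pdivlMr // (le_trans _ ka) // -EFinM lee_fin.
rewrite [leRHS]mulrAC -[leLHS]mulrA ler_wpM2l ?mulr_ge0 // mulrC ler_pdivrMr //.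
by rewrite -natrM mulnC ler_nat.
Qed.

End Liminf.

(** * Linear lower bounds from cutsets *)

Section CutsetBounds.
Context {R : realType} {G : multigraph}.
Local Notation E := (edge G).

Lemma iid_product_law (d : measure_display) (T : measurableType d)
    (P : probability T R) (nu : probability (measurableTypeR R) R)
    (w : E -> {RV P >-> R}) (J : {fset E}) : iid_weights nu w ->
  @product_law R E _ _ T P (measurableTypeR R) nu J w.
Proof.
move=> [_ law indep] A mA; rewrite indep //.
by apply: eq_bigr => e _; exact: (law e (A e) (mA e)).
Qed.

(** The well-ordering provides a least geodesic, so that the default value of
    [the_geodesic] is not reached. *)
Lemma geodesic_sa_path (le : rel {fset E}) (w : E -> R) x y :
  sa_well_ordering le -> geodesics w x y !=set0 ->
  sa_paths x y (the_geodesic le w x y).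
Proof.
move=> wo [s sP].
have sub : {subset [pred s | `[< geodesics w x y s >]] <=
                   [pred s | `[< all_sa_paths s >]]}.
  by move=> t /asboolP[tP _]; apply/asboolP; exists x, y.
have [|m [[/asboolP gm lem] _]] := wo _ sub.
  by exists s; apply/asboolP.
rewrite /the_geodesic; case: xgetP => [t _ [[]]//|].
move=> /(_ m) []; split=> // t tP; apply: lem; exact/asboolP.
Qed.

(** A random set of edges meeting all the cutsets has an edge with weight in [A]
    in each cutset all of whose weights are in [A].  The set may depend on the
    weights in any way, even not measurably. *)
Lemma path_edge_count_ge (d : measure_display) (T : measurableType d)
    (P : probability T R) (nu : probability (measurableTypeR R) R)
    (w : E -> {RV P >-> R}) (N k : nat) (F : nat -> {fset E}) (A : set R)
    (path : T -> {fset E}) :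
  iid_weights nu w -> measurable A ->
  (forall i, (#|` F i| <= N)%N) ->
  (forall i j e, e \in F i -> e \in F j -> i = j) ->
  {ae P, forall t, forall i, (i < k)%N -> exists2 e, e \in F i & e \in path t} ->
  ((1 * k%:R * fine (nu A) ^+ N)%:E <=
     'E_P[fun t => edge_count (path t) (fun e => w e t) A])%E.
Proof.
move=> Hw mA FN disjF meetF; rewrite unlock.
apply: (integral_ge_sum_events
  (B := fun i => \bigcap_(e in [set` F i]) w e @^-1` A)) => //.
- move=> i _; apply: fin_bigcap_measurable => // e _.
  by rewrite -[X in measurable X]setTI; exact: measurable_funP.
- by move=> i _; apply: product_law_ge (FN i) => //; exact: iid_product_law.
- by move=> t; apply: sumr_ge0 => e _; rewrite indicE.
apply: filterS meetF => t meet.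
apply: (@disjoint_family_sum_le E R F k (path t) (fun e => \1_A (w e t)) 1
  (fun i => t \in \bigcap_(e in [set` F i]) w e @^-1` A)) => //.
by move=> i /set_mem At e eF; rewrite indicE mem_set //; exact: At.
Qed.

Lemma fset_seq_ubound (ss : seq {fset E}) :
  exists J : {fset E}, forall s, s \in ss -> (s `<=` J)%fset.
Proof.
elim: ss => [|s ss [J JP]]; first by exists fset0.
exists (s `|` J)%fset => t; rewrite inE => /predU1P[->|/JP tJ].
  exact: fsubsetUl.
exact: fsubset_trans tJ (fsubsetUr _ _).
Qed.

Lemma integral_best_time_eq (nu : set R -> \bar R) (J : {fset E}) s0 ss
    (d1 d2 : measure_display) (T1 : measurableType d1) (T2 : measurableType d2)
    (P1 : probability T1 R) (P2 : probability T2 R)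
    (X1 : E -> T1 -> R) (X2 : E -> T2 -> R) :
  (forall s, s \in s0 :: ss -> (s `<=` J)%fset) ->
  (forall e, measurable_fun setT (X1 e)) ->
  (forall e, measurable_fun setT (X2 e)) ->
  (forall e t, 0 <= X1 e t) -> (forall e t, 0 <= X2 e t) ->
  @product_law R E _ _ _ P1 (measurableTypeR R) nu J X1 ->
  @product_law R E _ _ _ P2 (measurableTypeR R) nu J X2 ->
  (\int[P1]_t (best_time s0 ss (fun e => X1 e t))%:E =
   \int[P2]_t (best_time s0 ss (fun e => X2 e t))%:E)%E.
Proof.
move=> sJ mX1 mX2 X10 X20 law1 law2.
(* The integrand has to be nonnegative on all configurations, also those with
   negative weights. *)
have best0 (v : E -> R) : (forall e, 0 <= v e) ->
    (best_time s0 ss v)%:E = (Num.max 0 (best_time s0 ss v))%:E.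
  move=> v0; congr (_%:E); apply/esym/max_idPr.
  by apply: best_time_ge => s _; exact: path_time_ge0.
under eq_integral do rewrite best0 //.
under [RHS]eq_integral do rewrite best0 //.
apply: (@product_law_integral R E nu J _ _ T1 T2 P1 P2 X1 X2
  (fun v => (Num.max 0 (best_time s0 ss v))%:E)) => //.
  apply/measurable_EFinP; apply: measurable_maxr; first exact: measurable_cst.
  exact: measurable_best_time.
by move=> v; rewrite lee_fin le_max lexx.
Qed.

(** Both expectations are computed on a space carrying independent copies of the
    coupling on the edges of the paths and of the cutsets.  There, the time of
    every path is larger for [X] than for [X'] by at least [delta] times the
    number of cutsets on which all the gaps are at least [delta]. *)
Lemma best_time_gap (nu nu' : probability (measurableTypeR R) R)
    (d0 d1 d2 : measure_display) (T0 : measurableType d0)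
    (T1 : measurableType d1) (T2 : measurableType d2)
    (P0 : probability T0 R) (P1 : probability T1 R) (P2 : probability T2 R)
    (X' X : {RV P0 >-> R}) (w : E -> {RV P1 >-> R}) (w' : E -> {RV P2 >-> R})
    (N k : nat) (F : nat -> {fset E}) (delta : R)
    (s0 : {fset E}) (ss : seq {fset E}) :
  iid_weights nu w -> iid_weights nu' w' -> has_law X nu -> has_law X' nu' ->
  (forall t, 0 <= X' t <= X t) -> 0 <= delta ->
  (forall i, (#|` F i| <= N)%N) ->
  (forall i j e, e \in F i -> e \in F j -> i = j) ->
  (forall s, s \in s0 :: ss ->
     forall i, (i < k)%N -> exists2 e, e \in F i & e \in s) ->
  (\int[P2]_t (best_time s0 ss (fun e => w' e t))%:E +
     (delta * k%:R * fine (P0 [set t | (delta <= X t - X' t)%R]) ^+ N)%:E <=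
   \int[P1]_t (best_time s0 ss (fun e => w e t))%:E)%E.
Proof.
move=> Hw Hw' lawX lawX' X'X delta0 FN disjF meetF.
set B := [set t | _ <= _].
have [w0 _ _] := Hw; have [w'0 _ _] := Hw'.
have X'0 t : 0 <= X' t by case/andP: (X'X t).
have X0 t : 0 <= X t by case/andP: (X'X t) => /le_trans; apply.
have mB : measurable B by exact: measurable_gap.
have [J JP] := fset_seq_ubound (s0 :: ss ++ mkseq F k).
have sJ s : s \in s0 :: ss -> (s `<=` J)%fset.
  by move=> sss; apply: JP; rewrite -cat_cons mem_cat sss.
have FJ i : (i < k)%N -> (F i `<=` J)%fset.
  move=> ik; apply: JP; rewrite -cat_cons mem_cat; apply/orP; right.
  by apply/mapP; exists i; rewrite // mem_iota.
case: (iid_copies_exist P0 J) => d [T [Q [Z [mZ lawZ]]]].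
pose v e := X \o Z e; pose v' e := X' \o Z e.
have mv e : measurable_fun setT (v e) by exact: measurableT_comp.
have mv' e : measurable_fun setT (v' e) by exact: measurableT_comp.
have v0 e t : 0 <= v e t by exact: X0.
have v'0 e t : 0 <= v' e t by exact: X'0.
have law_comp (Y : {RV P0 >-> R}) (mu : probability (measurableTypeR R) R) :
    has_law Y mu ->
    @product_law R E _ _ T Q (measurableTypeR R) mu J (fun e => Y \o Z e).
  move=> lawY A mA.
  have mYA e : measurable (Y @^-1` A e).
    rewrite -[X in measurable X]setTI.
    by apply: measurable_funP; [exact: measurableT|exact: mA].
  rewrite -[LHS]/(Q (\bigcap_(e in [set` J]) Z e @^-1` (Y @^-1` A e))) lawZ //.
  by apply: eq_bigr => e _; exact: (lawY (A e) (mA e)).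
rewrite (integral_best_time_eq (X1 := w) (X2 := v) sJ _ mv _ v0
  (iid_product_law J Hw) (law_comp X nu lawX)) //.
rewrite (integral_best_time_eq (X1 := w') (X2 := v') sJ _ mv' _ v'0
  (iid_product_law J Hw') (law_comp X' nu' lawX')) //.
pose C i := \bigcap_(e in [set` F i]) Z e @^-1` B.
have mC i : measurable (C i).
  apply: fin_bigcap_measurable => // e _.
  by rewrite -[X in measurable X]setTI; exact: mZ.
pose g t : R := delta * \sum_(i < k) \1_(C i) t.
have gE t : g t = delta * \sum_(i < k) (t \in C i)%:R.
  by congr (_ * _); apply: eq_bigr => i _; rewrite indicE.
have g0 t : 0 <= g t.
  by rewrite mulr_ge0 // sumr_ge0 // => i _; rewrite indicE.
have mg : measurable_fun setT g.
  apply: measurable_funM; first exact: measurable_cst.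
  by apply: measurable_sum => i; exact: measurable_indic.
have mbest (u : E -> T -> R) : (forall e, measurable_fun setT (u e)) ->
    measurable_fun setT (fun t => best_time s0 ss (fun e => u e t)).
  by move=> mu; exact: measurable_best_time_RV (fun e => RV_of Q (mu e)) s0 ss.
have g_int : ((delta * k%:R * fine (P0 B) ^+ N)%:E <= \int[Q]_t (g t)%:E)%E.
  apply: (integral_ge_sum_events (B := C)) => //.
    move=> i ik; apply: product_law_ge (FN i) => //.
    exact: product_lawS (FJ i ik) lawZ.
  by apply: aeW => t; rewrite gE.
apply: le_trans (leeD2l _ g_int) _.
have best0 t : 0 <= best_time s0 ss (fun e => v' e t).
  by apply: best_time_ge => s _; apply: path_time_ge0 => e; exact: X'0.
rewrite -ge0_integralD //; last 4 first.
- by move=> t _; rewrite lee_fin.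
- exact/measurable_EFinP/mbest.
- by move=> t _; rewrite lee_fin.
- exact/measurable_EFinP.
apply: ge0_le_integral_nonmeasurable => t; rewrite -EFinD lee_fin ?addr_ge0 //.
apply: best_time_ge => s sss.
have le_s := best_time_le (fun e => v' e t) sss.
apply: le_trans (lerD le_s (lexx _)) _.
rewrite addrC -lerBrDr /path_time -sumrB gE.
apply: (@disjoint_family_sum_le E R F k s (fun e => v e t - v' e t) delta
  (fun i => t \in C i)) => //.
- exact: meetF.
- by move=> e; rewrite subr_ge0; case/andP: (X'X (Z e t)).
- by move=> i /set_mem Ct e eF; exact: Ct.
Qed.

(** The constant does not depend on the number of paths in [best_time_gap]. *)
Lemma passage_time_gap (nu nu' : probability (measurableTypeR R) R)
    (d0 d1 d2 : measure_display) (T0 : measurableType d0)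
    (T1 : measurableType d1) (T2 : measurableType d2)
    (P0 : probability T0 R) (P1 : probability T1 R) (P2 : probability T2 R)
    (X' X : {RV P0 >-> R}) (w : E -> {RV P1 >-> R}) (w' : E -> {RV P2 >-> R})
    (N k : nat) (F : nat -> {fset E}) (delta : R) (x y : vertex G) :
  ambient_graph G -> finite_mean nu -> finite_mean nu' ->
  iid_weights nu w -> iid_weights nu' w' -> has_law X nu -> has_law X' nu' ->
  (forall t, 0 <= X' t <= X t) -> 0 <= delta ->
  (forall i, (#|` F i| <= N)%N) ->
  (forall i j e, e \in F i -> e \in F j -> i = j) ->
  (forall s, sa_paths x y s ->
     forall i, (i < k)%N -> exists2 e, e \in F i & e \in s) ->
  ((delta * k%:R * fine (P0 [set t | (delta <= X t - X' t)%R]) ^+ N)%:E <=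
   'E_P1[fun t => passage_time (fun e => w e t) x y] -
   'E_P2[fun t => passage_time (fun e => w' e t) x y])%E.
Proof.
move=> HG mean mean' Hw Hw' lawX lawX' X'X delta0 FN disjF meetF.
have [S rangeS] := sa_paths_enumeration x y HG.
have [w0 _ _] := Hw; have [w'0 _ _] := Hw'.
have [_ cvgT] := expected_best_time_cvg rangeS Hw mean.
have [iT' _] := expected_best_time_cvg rangeS Hw' mean'.
rewrite unlock leeBrDr; last exact: integrable_fin_num.
rewrite addeC; apply: (cvge_ge _ cvgT); apply: nearW => n.
have S_sa s : s \in S 0%N :: mkseq S n -> sa_paths x y s.
  rewrite -rangeS inE => /predU1P[->|/mapP[i _ ->]]; first by exists 0%N.
  by exists i.
apply: le_trans (best_time_gap (s0 := S 0%N) (ss := mkseq S n)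
  Hw Hw' lawX lawX' X'X delta0 FN disjF (fun s ss => meetF s (S_sa s ss))).
rewrite leeD2r //; apply: ge0_le_integral_nonmeasurable => t; rewrite lee_fin.
  by apply: (passage_time_ge0 rangeS) => e; exact: w'0.
by apply: (passage_time_le_best_time rangeS) => e; exact: w'0.
Qed.

End CutsetBounds.

(** * Absolute continuity and strict monotonicity *)

Theorem theorem1p5 (R : realType) (G : multigraph)
    (HG : ambient_graph G) (Hdeg : bounded_degree G)
    (Hqi : quasi_isometric_to_tree R G)
    (nu : probability (measurableTypeR R) R)
    (Hnu : prob_nonneg nu) (Hmean : finite_mean nu)
    (d : measure_display) (Omega : measurableType d) (P : probability Omega R)
    (w : edge G -> {RV P >-> R}) (Hw : iid_weights nu w) :
  (forall le : rel {fset edge G},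
     sa_well_ordering le ->
     {ae P, forall t, forall x y, geodesics (fun e => w e t) x y !=set0} ->
     forall A : set R, measurable A -> A `<=` `[0, +oo[%classic ->
       (0 < nu A)%E ->
       (0 < liminf_dist (fun x y : vertex G =>
          'E_P[fun t => edge_count (the_geodesic le (fun e => w e t) x y)
                          (fun e => w e t) A] / (gdist x y)%:R%:E))%E)
  /\
  (forall nu' : probability (measurableTypeR R) R,
     prob_nonneg nu' -> finite_mean nu' -> strictly_dominates nu nu' ->
     forall (d' : measure_display) (Omega' : measurableType d')
            (P' : probability Omega' R) (w' : edge G -> {RV P' >-> R}),
     iid_weights nu' w' ->
     (0 < liminf_dist (fun x y : vertex G =>
        ('E_P[fun t => passage_time (fun e => w e t) x y] -
         'E_P'[fun t => passage_time (fun e => w' e t) x y])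
          / (gdist x y)%:R%:E))%E).
Proof.
have [connG _ _] := HG.
have [N [M [n0 cut]]] := quasi_tree_cutsets connG Hdeg Hqi.
(* The successor of [M] avoids treating the case [M = 0] apart. *)
have c_gt0 (delta : R) d0 (T0 : measurableType d0) (mu : probability T0 R)
    (B : set T0) :
    measurable B -> 0 < delta -> (0 < mu B)%E ->
    0 < delta * fine (mu B) ^+ N / M.+1%:R.
  move=> mB delta0 muB; rewrite divr_gt0 ?mulr_gt0 ?exprn_gt0 //.
  by rewrite fine_gt0 // muB ltey_eq fin_num_measure.
have bound (x y : vertex G) (k : nat) :
    (0 < gdist x y <= M * k)%N -> (0 < gdist x y <= M.+1 * k)%N.
  by move=> /andP[-> /leq_trans]; apply; rewrite leq_mul2r leqnSn orbT.
split.
  move=> le wo geo A mA _ nuA.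
  apply: (liminf_dist_gt0 (n0 := n0) (c_gt0 1 _ _ nu A mA ltr01 nuA)) => x y xy.
  have [k [F [dk FN disjF meetF]]] := cut x y xy.
  apply: (linear_lower_bound ler01 _ (bound _ _ _ dk)).
    by rewrite exprn_ge0 // fine_ge0.
  apply: (path_edge_count_ge Hw mA FN disjF).
  apply: filterS geo => t geot i ik; apply: meetF => //.
  exact: geodesic_sa_path.
move=> nu' Hnu' Hmean' dom d' Omega' P' w' Hw'.
have [d0 [T0 [P0 [X' [X [delta [lawX' lawX X'X delta0 P0B]]]]]]] :=
  strict_coupling Hnu Hnu' dom.
have mB : measurable [set t | delta <= X t - X' t].
  exact: measurable_gap.
apply: (liminf_dist_gt0 (n0 := n0) (c_gt0 delta _ _ P0 _ mB delta0 P0B)) => x y xy.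
have [k [F [dk FN disjF meetF]]] := cut x y xy.
apply: (linear_lower_bound (ltW delta0) _ (bound _ _ _ dk)).
  by rewrite exprn_ge0 // fine_ge0.
exact: (passage_time_gap HG Hmean Hmean' Hw Hw' lawX lawX' X'X (ltW delta0)
  FN disjF meetF).
Qed.
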